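(* For integers $n,k$ with $n\ge 2$ and $2\le k<2^{n-1}$, the number $\tau_{n,k}$ of separating families of $k$ arbitrary bipartitions over an $n$-element set is $$\tau_{n,k}=\sum_{i=1}^{n-1}(-1)^{n-1-i}\left[{n \atop i+1}\right]\binom{2^i}{k}.$$
   Context: A bipartition of a set $S$ is a partition of $S$ into at most two nonempty components (so the trivial partition $\{S\}$ is a bipartition). A bipartition cuts two elements if they lie in different components. A family of bipartitions of $S$ is a separating family for $S$ if every two distinct elements of $S$ are cut by some bipartition in the family. $\tau_{n,k}$ is the number of separating families consisting of $k$ distinct bipartitions of a fixed $n$-element set. $\left[{a \atop b}\right]$ denotes the unsigned Stirling number of the first kind (number of permutations of $a$ elements with exactly $b$ cycles). *)

(* Defs.v *)
From mathcomp Require Import all_boot all_order all_fingroup all_algebra.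

Set Implicit Arguments.
Unset Strict Implicit.
Unset Printing Implicit Defensive.

Section Bipartitions.

Variable T : finType.

Implicit Types (P : {set {set T}}) (F : {set {set {set T}}}).

(* The components of a [partition] are nonempty, so the trivial partition
   [set [set: T]] is a bipartition when T is nonempty. *)
Definition bipartition P : bool := partition P [set: T] && (#|P| <= 2).

(* [pblock P x] is the component of P containing x. *)
Definition cuts P (x y : T) : bool := pblock P x != pblock P y.

Definition separating_family F : bool :=
  [forall P in F, bipartition P] &&
  [forall x : T, forall y : T, (x != y) ==> [exists P in F, cuts P x y]].

(* F is a set, so #|F| == k means k pairwise distinct bipartitions. *)
Definition tau (k : nat) : nat :=
  #|[set F : {set {set {set T}}} | separating_family F && (#|F| == k)]|.

End Bipartitions.

(* [porbits s] is the set of all cycles of s, including the fixed points. *)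
Definition stirling1 (a b : nat) : nat := #|[set s : 'S_a | #|porbits s| == b]|.

(* Main.v *)
(** Count the pairs of a permutation [s] of [T] and a k-family of
    bipartitions none of which cuts an orbit of [s], weighted by sign.  A
    bipartition cutting no orbit amounts to a set of orbits avoiding a fixed
    one, so [s] with [c] cycles contributes [(-1)^(n-c) 'C(2^(c-1), k)], and
    grouping by [c] gives the right-hand side.  Summing over families first,
    a separating family only tolerates [s = 1] and contributes 1; if a family
    separates no pair [{x, y}], composition with the transposition [(x y)] is
    a sign-reversing involution and it contributes 0. *)
Require Import Defs.
From mathcomp Require Import all_boot all_order all_fingroup all_algebra.

Set Implicit Arguments.
Unset Strict Implicit.
Unset Printing Implicit Defensive.

Import GRing.Theory.
Local Open Scope ring_scope.

Lemma eq_pblock_preim (T : finType) (rT : eqType) (f : T -> rT) (x y : T) :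
  (pblock (preim_partition f [set: T]) x ==
   pblock (preim_partition f [set: T]) y) = (f x == f y).
Proof.
have /and3P [/eqP covP tiP _] := preim_partitionP f [set: T].
rewrite eq_pblock ?covP ?inE // pblock_equivalence_partition ?inE //.
by move=> u v w _ _ _; split=> // /eqP ->.
Qed.

Lemma card_preim_partition (T rT : finType) (f : T -> rT) (D : {set T}) :
  (#|preim_partition f D| <= #|rT|)%N.
Proof.
rewrite /preim_partition /equivalence_partition.
have -> : [set [set y in D | f x == f y] | x in D] =
    [set [set y in D | z == f y] | z in [set f x | x in D]].
  by rewrite -imset_comp.
exact: leq_trans (leq_imset_card _ _) (max_card _).
Qed.

Lemma eq_preim_partition (T : finType) (rT rT' : eqType) (f : T -> rT)
    (g : T -> rT') (D : {set T}) :
  (forall x y, (f x == f y) = (g x == g y)) ->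
  preim_partition f D = preim_partition g D.
Proof.
by move=> efg; apply: eq_imset => x; apply/setP=> y; rewrite !inE efg.
Qed.

(** If [x] and [y] both lay outside the component of [x0] and in different components, there would
    be three components. Hence a bipartition is determined by which points share the component of
    the base point [x0]. *)
Lemma bipartition_pblock (T : finType) (P : {set {set T}}) (x0 x y : T) :
  bipartition P ->
  (pblock P x == pblock P y) =
  ((pblock P x == pblock P x0) == (pblock P y == pblock P x0)).
Proof.
case/andP=> /and3P [/eqP covP _ _] leP2.
have inP z : pblock P z \in P by rewrite pblock_mem // covP inE.
have [->|neqx] := eqVneq (pblock P x) (pblock P x0); first by rewrite eq_sym.
have [->|neqy] := eqVneq (pblock P y) (pblock P x0); first exact/negbTE.
apply: contraLR leP2 => neqxy; rewrite -ltnNge.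
rewrite (cardsD1 (pblock P x)) (cardsD1 (pblock P y)) inP.
rewrite (cardsD1 (pblock P x0)) !inE !inP [pblock P y == _]eq_sym neqxy.
by rewrite ![pblock P x0 == _]eq_sym neqx neqy.
Qed.

Definition uncut_bipartitions (T : finType) (s : {perm T}) :
    {set {set {set T}}} :=
  [set P | bipartition P & [forall x, ~~ cuts P x (s x)]].

Lemma uncut_porbit (T : finType) (s : {perm T}) (P : {set {set T}}) (x y : T) :
  P \in uncut_bipartitions s -> porbit s x = porbit s y ->
  pblock P x = pblock P y.
Proof.
rewrite inE => /andP [_ /forallP uncutP] /eqP; rewrite eq_porbit_mem.
case/porbitP=> i ->; elim: i => [|i IHi]; first by rewrite expg0 perm1.
rewrite expgSr permM -IHi.
by have /negbNE/eqP <- := uncutP ((s ^+ i)%g y).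
Qed.

(** [D] collects the orbits outside the component of [x0]. A set of orbits and its complement induce
    the same bipartition; excluding the orbit of [x0] selects one of the two. *)
Lemma uncut_bipartitions_imset (T : finType) (s : {perm T}) (x0 : T) :
  uncut_bipartitions s =
  [set preim_partition (fun x => porbit s x \in D) [set: T] |
    D : {set {set T}} in powerset (porbits s :\ porbit s x0)].
Proof.
apply/setP=> P; apply/idP/imsetP => [uncutP | [D _ ->]]; last first.
  rewrite inE /bipartition preim_partitionP /=; apply/andP; split.
    by rewrite -card_bool; apply: card_preim_partition.
  apply/forallP=> x; rewrite negbK eq_pblock_preim.
  by have := mem_porbit s 1 x; rewrite expg1 -eq_porbit_mem => /eqP ->.
have bipP : bipartition P by move: uncutP; rewrite inE => /andP [].
pose D := [set porbit s x | x in [pred x | pblock P x != pblock P x0]].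
have memD x : (porbit s x \in D) = (pblock P x != pblock P x0).
  apply/imsetP/idP => [[y + eqxy]|]; last by exists x.
  by rewrite inE (uncut_porbit uncutP eqxy).
exists D.
  rewrite inE; apply/subsetP=> _ /imsetP [x + ->]; rewrite !inE => neqx.
  rewrite imset_f // andbT; apply: contra neqx => /eqP.
  by move/(uncut_porbit uncutP) ->.
have /andP [partP _] := bipP.
rewrite -{1}(preim_partition_pblock partP); apply: eq_preim_partition => x y.
rewrite !memD (bipartition_pblock x0 x y bipP).
by case: (pblock P x == _); case: (pblock P y == _).
Qed.

Lemma card_uncut_bipartitions (T : finType) (s : {perm T}) (x0 : T) :
  #|uncut_bipartitions s| = (2 ^ #|porbits s|.-1)%N.
Proof.
rewrite (uncut_bipartitions_imset s x0) card_in_imset; last first.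
  move=> D E; rewrite !inE => sD sE eqDE.
  have nx0 (C : {set {set T}}) :
      C \subset porbits s :\ porbit s x0 -> (porbit s x0 \in C) = false.
    by move/subsetP=> sC; apply/negP=> /sC; rewrite !inE eqxx.
  apply/setP=> A; case AP: (A \in porbits s); last first.
    transitivity false; [|symmetry]; apply: contraFF AP.
      by move/(subsetP sD); rewrite inE => /andP [].
    by move/(subsetP sE); rewrite inE => /andP [].
  case/imsetP: AP => x _ ->.
  (* The orbit of [x0] is in neither [D] nor [E], so whether the orbit of [x] belongs to either set
     is read off from whether the partition cuts [x] from [x0]. *)
  have := eq_pblock_preim (fun x => porbit s x \in D) x x0.
  rewrite eqDE eq_pblock_preim (nx0 _ sD) (nx0 _ sE).
  by case: (_ \in D); case: (_ \in E).
by rewrite card_powerset (cardsD1 (porbit s x0)) imset_f.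
Qed.

(** Transport along a bijection [f] from [T] to [U] conjugates permutations and maps orbits to
    orbits. The inequality suffices, since it can be applied in both directions. *)
Lemma leq_card_perm_porbits (T U : finType) (m : nat) : #|T| = #|U| ->
  (#|[set s : {perm T} | #|porbits s| == m]| <=
   #|[set s : {perm U} | #|porbits s| == m]|)%N.
Proof.
move=> eqTU.
pose f (x : T) : U := enum_val (cast_ord eqTU (enum_rank x)).
pose g (y : U) : T := enum_val (cast_ord (esym eqTU) (enum_rank y)).
have fK : cancel f g by move=> x; rewrite /f /g enum_valK cast_ordK enum_rankK.
have gK : cancel g f by move=> x; rewrite /f /g enum_valK cast_ordKV enum_rankK.
have inj (s : {perm T}) : injective (fun y => f (s (g y))).
  exact: inj_comp (can_inj fK) (inj_comp (@perm_inj _ s) (can_inj gK)).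
pose conj s : {perm U} := perm (@inj s).
have conjE s x : conj s (f x) = f (s x) by rewrite permE fK.
have conjX s i x : (conj s ^+ i)%g (f x) = f ((s ^+ i)%g x).
  by elim: i => [|i IHi]; rewrite ?expg0 ?perm1 // !expgSr !permM IHi conjE.
have conj_inj : injective conj.
  move=> s t eqst; apply/permP=> x; apply: (can_inj fK).
  by rewrite -!conjE eqst.
have porbit_conj s x : porbit (conj s) (f x) = f @: porbit s x.
  apply/setP=> y; apply/porbitP/imsetP => [[i ->]|[_ /porbitP [i ->] ->]].
    by exists ((s ^+ i)%g x); rewrite ?mem_porbit ?conjX.
  by exists i; rewrite conjX.
have card_porbits s : #|porbits (conj s)| = #|porbits s|.
  rewrite -(card_imset _ (imset_inj (can_inj fK))); congr #|pred_of_set _|.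
  apply/setP=> A; apply/imsetP/imsetP => [[y _ ->]|[_ /imsetP [x _ ->] ->]].
    by exists (porbit s (g y)); rewrite ?imset_f // -porbit_conj gK.
  by exists (f x); rewrite ?porbit_conj.
rewrite -(card_imset _ conj_inj) subset_leq_card //.
by apply/subsetP=> _ /imsetP [s + ->]; rewrite !inE card_porbits.
Qed.

Lemma card_perm_porbits (T : finType) (m : nat) :
  #|[set s : {perm T} | #|porbits s| == m]| = stirling1 #|T| m.
Proof.
have eqT : #|T| = #|'I_#|T| | by rewrite card_ord.
by apply/eqP; rewrite eqn_leq !leq_card_perm_porbits.
Qed.

Lemma sum_sign_uncut (T : finType) (F : {set {set {set T}}}) :
  \sum_(s : {perm T} | F \subset uncut_bipartitions s) (-1) ^+ s =
  (separating_family F : nat)%:Z.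
Proof.
have [sepF|] := boolP (separating_family F).
  case/andP: sepF => /forall_inP bipF /forallP sepF.
  rewrite (bigD1 1%g) /=; last first.
    apply/subsetP=> P /bipF bipP; rewrite inE bipP.
    by apply/forallP=> x; rewrite perm1 negbK.
  (* If [s] moved some [x], a member of [F] would cut [x] from [s x], two points of one orbit. *)
  rewrite odd_perm1 big1 ?addr0 // => s /andP [/subsetP uncutF /eqP []].
  apply/permP=> x; rewrite perm1; apply/eqP; apply: contraT => neqx.
  move/forallP: (sepF x) => /(_ (s x)); rewrite eq_sym neqx.
  case/exists_inP=> P /uncutF; rewrite inE => /andP [_ /forallP /(_ x)].
  by move/negP.
rewrite negb_and => /orP [|nsepF].
  (* A member of [F] that is not a bipartition makes the sum empty. *)
  case/forall_inPn=> P PF nbipP; rewrite big_pred0 // => s.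
  apply: contraNF nbipP => /subsetP /(_ P PF).
  by rewrite inE => /andP [].
have [x [y [neqxy uncutF]]] : exists x y,
    x != y /\ {in F, forall P, pblock P x = pblock P y}.
  move: nsepF => /forallPn [x /forallPn [y]]; rewrite negb_imply.
  case/andP=> neqxy /exists_inPn uncutF; exists x, y; split=> // P PF.
  by have := uncutF P PF; rewrite negbK => /eqP.
have pblock_tperm P z : P \in F -> pblock P (tperm x y z) = pblock P z.
  by move=> /uncutF eqxy; case: tpermP => // ->.
have uncut_tperm (s : {perm T}) : (F \subset uncut_bipartitions s) ->
    F \subset uncut_bipartitions (tperm x y * s)%g.
  move=> /subsetP uncuts; apply/subsetP=> P PF.
  have := uncuts P PF; rewrite !inE => /andP [-> /forallP uncutP] /=.
  apply/forallP=> z; rewrite negbK permM -(pblock_tperm P z PF).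
  by have := uncutP (tperm x y z); rewrite negbK.
set S := \sum_(s | _) _.
have eqS : S = - S.
  rewrite {1}/S (reindex_inj (mulgI (tperm x y))) -sumrN.
  apply: eq_big => [s|s _].
    (* The transposition is its own inverse, so preservation in one direction yields the other. *)
    apply/idP/idP => /uncut_tperm //.
    by rewrite mulgA tperm2 mul1g.
  by rewrite odd_mul_tperm neqxy /= signrN.
have /eqP : S + S = 0 by rewrite {1}eqS addNr.
by rewrite -mulr2n Num.Theory.mulrn_eq0 => /eqP.
Qed.

Lemma tau_sum_perm (T : finType) (k : nat) (x0 : T) :
  (tau T k)%:Z =
  \sum_(s : {perm T}) (-1) ^+ s * ('C(2 ^ #|porbits s|.-1, k))%:Z.
Proof.
transitivity (\sum_(s : {perm T})
    \sum_(F : {set {set {set T}}} | #|F| == k)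
      if F \subset uncut_bipartitions s then (-1) ^+ s else 0 : int).
  rewrite exchange_big /= /tau -sum1_card raddf_sum /=.
  under [RHS]eq_bigr => F _ do rewrite -big_mkcond sum_sign_uncut.
  rewrite big_mkcond [RHS]big_mkcond; apply: eq_bigr => F _.
  by rewrite inE andbC; case: (_ == k); case: separating_family.
apply: eq_bigr => s _.
(* The binomial counts the [k]-subsets of the set of bipartitions that cut no orbit of [s]. *)
rewrite -(card_uncut_bipartitions s x0) -cards_draws -sum1_card raddf_sum.
rewrite mulr_sumr -big_mkcondr.
by apply: eq_big => [F|F _]; rewrite ?inE 1?andbC ?mulr1.
Qed.

Theorem theorem3p16 (n k : nat) (T : finType)
    (hT : #|T| = n) (hn : (2 <= n)%N) (hk : (2 <= k < 2 ^ n.-1)%N) :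
  (tau T k)%:Z =
  \sum_(1 <= i < n)
     (-1) ^+ (n.-1 - i) * (stirling1 n i.+1)%:Z * ('C(2 ^ i, k))%:Z.
Proof.
have [x0 _] : exists x0 : T, x0 \in T.
  by apply/card_gt0P; rewrite hT (ltn_trans _ hn).
have bin1k : 'C(1, k) = 0%N by case/andP: hk => k_gt1 _; rewrite bin_small.
rewrite (tau_sum_perm k x0).
have le_porbits (s : {perm T}) : (#|porbits s| < n.+1)%N.
  by rewrite ltnS -hT leq_imset_card.
rewrite (partition_big (fun s => Ordinal (le_porbits s)) predT) //=.
transitivity (\sum_(0 <= j < n.+1)
    (-1) ^+ (#|T| + j) * (stirling1 #|T| j)%:Z * ('C(2 ^ j.-1, k))%:Z : int).
  rewrite big_mkord; apply: eq_bigr => j _.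
  rewrite -card_perm_porbits -sum1_card raddf_sum mulr_sumr mulr_suml.
  apply: eq_big => [s|s /eqP <-]; rewrite ?inE //= mulr1.
  (* The parity of a permutation is by definition that of [#|T|] plus its number of orbits. *)
  by rewrite -[in RHS]signr_odd oddD.
(* For [j = 0] (where [j.-1] truncates to 0) and [j = 1] the binomial is ['C(1, k)], which vanishes
   as [k] is at least 2. The rest is reindexed by [j = i.+1]. *)
rewrite hT [LHS]big_ltn // [X in _ + X = _]big_ltn ?ltnS ?(ltnW hn) //=.
rewrite expn0 bin1k !mulr0 !add0r.
rewrite big_add1 /=; apply: eq_big_nat => i /andP [i_gt0 lt_in].
rewrite -signr_odd -[in RHS]signr_odd; congr ((-1) ^+ nat_of_bool _ * _ * _).
(* This bound makes the truncated [n.-1 - i] a true difference, of the same parity as [n + i.+1]. *)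
have le_in : (i <= n.-1)%N by rewrite -ltnS prednK // (ltn_trans _ hn).
by rewrite oddB // -{1}(prednK (ltnW hn)) addSn addnS /= oddD negbK.
Qed.
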